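(* For every integer $n\ge1$, let $\gamma^{\mathrm{pnest}}_{\mathcal A(2n)}(t)$ be the gamma-polynomial of the symmetric polynomial $\mathrm{Pnest}_{\mathcal A(2n)}(t)/t$, where $\mathrm{Pnest}_{\mathcal A(m)}(t)=\sum_{\mathbf a\in\mathcal A(m)}t^{\mathrm{pnest}(\mathbf a)}$. Then $$\gamma^{\mathrm{pnest}}_{\mathcal A(2n)}(t)=\sum_{i=0}^{\lfloor\frac{n-1}{2}\rfloor}2^{2i+1}\binom{n}{2i+1}t^i=\frac{(1+2\sqrt t)^n-(1-2\sqrt t)^n}{2\sqrt t}.$$ Moreover, for each such $i$, $2^{2i+1}\binom{n}{2i+1}$ is the number of Abelian Dyck paths $(k,L)$ of semilength $2n$ with peak-nesting $i+1$ such that, writing the augmented word $LN=S_1S_2\cdots S_{2n}S_{2n+1}$ (obtained by appending a step $N$ to $L$), there is no $j\in[n]$ with $S_{2j-1}S_{2j}S_{2j+1}=ENE$ or $S_{2j-1}S_{2j}S_{2j+1}=NEN$.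
   Context: Write $[n]=\{1,\dots,n\}$. An area sequence of size $m$ is a sequence $\mathbf a=(a_1,\dots,a_m)$ of nonnegative integers with $a_i<i$ for all $i$ and $a_i\le a_{i-1}+1$ for all $i\ge 2$. Each area sequence $\mathbf a$ defines a graph $\Gamma_{\mathbf a}$ (a unit interval graph) on $[m]$ with edges $\{j,i\}$ for $1\le j<i\le m$ with $i-a_i\le j$. If $\{i,j\}$ with $i<j$ is an edge then $\{i,i+1,\dots,j\}$ is a clique. A peak-edge of $\Gamma_{\mathbf a}$ is either an isolated vertex $i$ (put $j=i$) or an edge $\{i,j\}$, $i<j$, such that neither $\{i,j+1\}$ nor $\{i-1,j\}$ is an edge (pairs not contained in $[m]$ are not edges). The corresponding peak-clique is $\{i,\dots,j\}$. The peak-nesting of a vertex is the number of peak-cliques containing it, and $\mathrm{pnest}(\mathbf a)$ is the maximum over all vertices. $\mathbf a$ is Abelian if every vertex $i\ne 1,m$ of $\Gamma_{\mathbf a}$ is adjacent to at least one of $1$ and $m$; $\mathcal A(m)$ is the set of Abelian area sequences of size $m$. Area sequences of size $m$ correspond bijectively to Dyck paths of semilength $m$, i.e. lattice paths from $(0,0)$ to $(m,m)$ with steps $N=(0,1)$, $E=(1,0)$ staying weakly above the diagonal: the $i$-th $N$ step of the path lies on the line $x=i-1-a_i$. Statistics of $\mathbf a$ are transferred to its Dyck path. A Dyck path is Abelian if its area sequence is. Every Abelian Dyck path of semilength $m$ is uniquely of the form $N^kLE^{m-k}$ with $1\le k\le m$ and $L$ a path with steps $N,E$ from $(0,k)$ to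 $(k,m)$ whose first step is $E$; it is denoted $(k,L)$, and conversely each such pair gives an Abelian Dyck path. A polynomial $p(t)$ of degree $d$ is symmetric if $p(t)=t^dp(1/t)$; then $p(t)=\sum_{0\le 2i\le d}\gamma_it^i(1+t)^{d-2i}$ uniquely and $\gamma_p(t)=\sum_i\gamma_it^i$ is its gamma-polynomial. *)

(* Defs.v *)
From HB Require Import structures.
From mathcomp Require Import all_boot all_order all_algebra.

Set Implicit Arguments.
Unset Strict Implicit.
Unset Printing Implicit Defensive.

Import GRing.Theory.

Local Open Scope nat_scope.

(* Indices and vertices are shifted from [m] = {1, ..., m} to
   'I_m = {0, ..., m - 1}: a i stands for a_(i+1).  The condition
   a_(i+1) < i + 1 makes 'I_m a large enough type of values, so that the area
   sequences of size m form a finite set. *)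
Definition area_seq m (a : {ffun 'I_m -> 'I_m}) : bool :=
  [forall i : 'I_m, a i < i.+1] &&
  [forall i : 'I_m, forall j : 'I_m, (i == j.+1 :> nat) ==> (a i <= (a j).+1)].

Section UnitIntervalGraph.

Variables (m : nat) (a : {ffun 'I_m -> 'I_m}).

(* Adjacency in Gamma_a; the inequality i - a_i <= j is invariant under the
   index shift, and the subtraction does not truncate since a i <= i. *)
Definition edge (i j : 'I_m) : bool :=
  ((j < i) && (i - a i <= j)) || ((i < j) && (j - a j <= i)).

Definition isolated (i : 'I_m) : bool := [forall k, ~~ edge i k].

Definition peak_edge (i j : 'I_m) : bool :=
  ((i == j) && isolated i) ||
  [&& i < j, edge i j,
      [forall k : 'I_m, (k == j.+1 :> nat) ==> ~~ edge i k] &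
      [forall k : 'I_m, (i == k.+1 :> nat) ==> ~~ edge k j]].

Definition peak_cliques : {set {set 'I_m}} :=
  [set [set v : 'I_m | p.1 <= v <= p.2]
     | p : 'I_m * 'I_m in [pred p | peak_edge p.1 p.2]].

Definition peak_nesting (v : 'I_m) : nat :=
  #|[set C in peak_cliques | v \in C]|.

Definition pnest : nat := \max_(v : 'I_m) peak_nesting v.

Definition abelian : bool :=
  [forall i : 'I_m, (i != 0 :> nat) && (i.+1 != m) ==>
     [exists k : 'I_m, ((k == 0 :> nat) || (k.+1 == m)) && edge i k]].

End UnitIntervalGraph.

Definition abelian_area_seqs m : {set {ffun 'I_m -> 'I_m}} :=
  [set a | area_seq a && abelian a].

Definition Pnest m : {poly int} :=
  (\sum_(a in abelian_area_seqs m) 'X^(pnest a))%R.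

Inductive step := N | E.

Definition bool_of_step s := if s is N then true else false.
Definition step_of_bool b := if b then N else E.
Lemma bool_of_stepK : cancel bool_of_step step_of_bool. Proof. by case. Qed.

HB.instance Definition _ := Countable.copy step (can_type bool_of_stepK).
HB.instance Definition _ : isFinite step := CanIsFinite bool_of_stepK.

Definition dyck_path m (w : seq step) : bool :=
  [&& count_mem N w == m, count_mem E w == m &
      [forall p : 'I_(size w).+1,
         count_mem E (take p w) <= count_mem N (take p w)]].

(* The abscissae of the successive N steps of the path w starting at
   abscissa x. *)
Fixpoint N_abscissae (x : nat) (w : seq step) : seq nat :=
  match w with
  | [::] => [::]
  | N :: w' => x :: N_abscissae x w'
  | E :: w' => N_abscissae x.+1 w'
  end.

(* With 1-based indices, the i-th N step lies on the line x = i - 1 - a_i; after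
   the shift this reads a i = i - x.  The subtraction does not truncate when w
   is a Dyck path. *)
Definition area_of_path m (w : seq step) : {ffun 'I_m -> 'I_m} :=
  [ffun i : 'I_m =>
     Ordinal (leq_ltn_trans (leq_subr (nth 0 (N_abscissae 0 w) i) i)
                            (ltn_ord i))].

(* w is the Dyck path denoted (k, L): w = N^k L E^(m-k), where L goes from
   (0, k) to (k, m) and starts with an E step. *)
Definition path_pair m (k : nat) (L w : seq step) : bool :=
  [&& 1 <= k <= m, count_mem E L == k, count_mem N L == m - k,
      ohead L == Some E & w == nseq k N ++ L ++ nseq (m - k) E].

(* No 1 <= j <= n is such that S_(2j-1) S_(2j) S_(2j+1) is ENE or NEN, where
   S_1 ... S_(2n+1) = L N; here j is shifted by one. *)
Definition no_ENE_NEN n (L : seq step) : bool :=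
  [forall j : 'I_n,
     take 3 (drop (2 * j) (rcons L N)) \notin [:: [:: E; N; E]; [:: N; E; N]]].

Definition counted_paths n i : {set (2 * (2 * n)).-tuple step} :=
  [set w : (2 * (2 * n)).-tuple step |
     [&& dyck_path (2 * n) w,
         abelian (area_of_path (2 * n) w),
         pnest (area_of_path (2 * n) w) == i.+1 &
         [exists k : 'I_(2 * n).+1, exists L : (2 * n).-tuple step,
            path_pair (2 * n) k L w && no_ENE_NEN n L]]].

Local Open Scope ring_scope.

Definition degree (R : nzRingType) (p : {poly R}) : nat := (size p).-1.

(* The right-hand side is t^d p(1/t), with d the degree of p. *)
Definition symmetric_poly (R : nzRingType) (p : {poly R}) : Prop :=
  p = \poly_(i < (degree p).+1) p`_(degree p - i).

Definition gamma_expansion (R : nzRingType) (d : nat) (g : {poly R}) :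
    {poly R} :=
  \sum_(i < (d./2).+1) g`_i *: ('X^i * (1 + 'X) ^+ (d - 2 * i)).

Definition is_gamma_poly (R : nzRingType) (p g : {poly R}) : Prop :=
  (size g <= (degree p)./2.+1)%N /\ p = gamma_expansion (degree p) g.

Lemma is_gamma_poly_unique (R : comNzRingType) (p g h : {poly R}) :
  is_gamma_poly p g -> is_gamma_poly p h -> g = h.
Proof.
case=> sg pg [sh ph]; set d := degree p in sg pg sh ph.
have coef_exp (f : {poly R}) i : (i <= d./2)%N ->
    (gamma_expansion d f)`_i
      = f`_i + \sum_(j < i) f`_j * ('X^j * (1 + 'X) ^+ (d - 2 * j))`_i.
  move=> le_i; rewrite /gamma_expansion coef_sum.
  pose F j := f`_j * ('X^j * (1 + 'X) ^+ (d - 2 * j))`_i.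
  rewrite (eq_bigr (fun j : 'I_ _ => F j)); last by move=> j _; rewrite coefZ.
  rewrite -(big_mkord xpredT F) (big_cat_nat (n := i.+1)) //=.
  rewrite [X in _ + X]big1_seq ?addr0; last first.
    by move=> j /andP[_]; rewrite mem_index_iota => /andP[lt_ij _]; rewrite /F coefXnM lt_ij mulr0.
  rewrite big_nat_recr //= big_mkord addrC; congr (_ + _).
  rewrite /F coefXnM ltnn subnn -horner_coef0 !hornerE.
  by rewrite expr1n mulr1.
apply/polyP=> i; have [lt_i|ge_i] := ltnP i (d./2).+1; last first.
  by rewrite !nth_default // (leq_trans _ ge_i).
elim/ltn_ind: i lt_i => i IHi lt_i.
have := congr1 (fun q : {poly R} => q`_i) (etrans (esym pg) ph).
rewrite !coef_exp // => eq_gh.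
have {}IHi : \sum_(j < i) g`_j * ('X^j * (1 + 'X) ^+ (d - 2 * j))`_i
           = \sum_(j < i) h`_j * ('X^j * (1 + 'X) ^+ (d - 2 * j))`_i.
  by apply: eq_bigr => j _; rewrite IHi ?(ltn_trans _ lt_i).
by move: eq_gh; rewrite IHi => /addIr.
Qed.

(* Main.v *)
Require Import Defs.
From mathcomp Require Import all_boot all_order all_algebra.
From mathcomp Require Import zify ring.

(* Write an Abelian Dyck path of semilength m as N^k L E^(m-k), and let x_i be the
   abscissa of its i-th N step.  The right ends of the peak-cliques are the j with
   j = m or x_j < x_(j+1), and the clique of j is {x_j + 1, ..., j}.  All of them
   contain vertex k, except one with x_j = k, which is disjoint from the first
   clique.  Hence the peak-nesting is the number of factors EN in LN.  A word LN
   that starts with E is determined by the places where its letter changes, an odd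
   number 2r - 1 of them if EN occurs r times, so that Pnest(t)/t is the odd part,
   in s with s^2 = t, of (1 + s)^(2n) = ((1 + s^2) + 2s)^n; expanding the right-hand
   side shows that its gamma-polynomial is the odd part of (1 + 2s)^n.  Words
   without the forbidden factors have at most one change of letter in each of the n
   triples S_(2j-1) S_(2j) S_(2j+1), in one of two places, which gives
   (1 + 2s)^n again. *)

Set Implicit Arguments.
Unset Strict Implicit.
Unset Printing Implicit Defensive.

Import GRing.Theory Num.Theory.

(** * Peak-nesting of an Abelian area sequence *)

Section PeakNesting.

Variables (m : nat) (a : {ffun 'I_m -> 'I_m}) (x : nat -> nat).
Hypothesis aE : forall i : 'I_m, a i = i - x i :> nat.
Hypothesis x_le : forall i : 'I_m, x i <= i.
Hypothesis x_homo : {homo x : i j / i <= j}.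

Lemma edge_abscissa (i j : 'I_m) :
  edge a i j = ((j < i) && (x i <= j)) || ((i < j) && (x j <= i)).
Proof. by rewrite /edge !aE !subKn ?x_le. Qed.

Lemma area_seq_abscissa : area_seq a.
Proof.
apply/andP; split; first by apply/forallP => i; rewrite aE; lia.
apply/forallP => i; apply/forallP => j; apply/implyP => /eqP ij.
by rewrite !aE; have := @x_homo j i; lia.
Qed.

(** The neighbours of j below it are x_j, ..., j - 1, so maximality on the left forces i = x_j, and
    maximality on the right says that j + 1 is not adjacent to x_j. Isolated vertices are the case
    x_j = j; there monotonicity of [x] excludes all neighbours above at once. *)
Lemma peak_edge_abscissa (i j : 'I_m) :
  peak_edge a i j = (i == x j :> nat) && ((x j < x j.+1) || (j.+1 == m)).
Proof.
have lt_im := ltn_ord i; have lt_jm := ltn_ord j.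
apply/idP/idP.
- case/orP => [/andP[/eqP eq_ij /forallP iso]|/and4P[lt_ij]].
    have xi : x i = i.
      apply/eqP; rewrite eqn_leq x_le leqNgt; apply/negP => lt_xi.
      have := iso (Ordinal (ltn_trans lt_xi lt_im)).
      by rewrite edge_abscissa /=; lia.
    rewrite -eq_ij xi eqxx /=; have [//|neq] := eqVneq i.+1 m.
      by rewrite orbT.
    have lt_i1 : i.+1 < m by lia.
    have := iso (Ordinal lt_i1); rewrite edge_abscissa /=; lia.
  rewrite edge_abscissa => e_ij /forallP next /forallP prev.
  have xj : i = x j :> nat.
    apply/eqP; rewrite eqn_leq; apply/andP; split; last by lia.
    rewrite leqNgt; apply/negP => lt_xj.
    have lt_i1 : i.-1 < m by lia.
    by have := prev (Ordinal lt_i1); rewrite edge_abscissa /=; lia.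
  rewrite -xj eqxx /=; have [|neq] := eqVneq j.+1 m; first by rewrite orbT.
  have lt_j1 : j.+1 < m by lia.
  by have := next (Ordinal lt_j1); rewrite edge_abscissa /=; lia.
- case/andP => /eqP i_xj peak; have := x_le j.
  rewrite -i_xj leq_eqVlt => /orP[/eqP eq_ij|lt_ij].
    apply/orP; left; apply/andP; split; first exact/eqP/val_inj.
    apply/forallP => l; rewrite edge_abscissa.
    by have := @x_homo j.+1 l; have := ltn_ord l; rewrite eq_ij -i_xj in peak *; lia.
  apply/orP; right; apply/and4P; split => //.
  + by rewrite edge_abscissa; lia.
  + apply/forallP => l; apply/implyP => /eqP jl; rewrite edge_abscissa.
    by move: (ltn_ord l) peak; rewrite jl; lia.
  + apply/forallP => l; apply/implyP => /eqP jl; rewrite edge_abscissa.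
    by lia.
Qed.

Let clique (j : 'I_m) : {set 'I_m} := [set v : 'I_m | x j <= v <= j].
Let peaks : {set 'I_m} := [set j : 'I_m | (x j < x j.+1) || (j.+1 == m)].

(** A clique determines its right end as its maximum. Since [peak_nesting] counts cliques as sets,
    this allows counting right ends instead. *)
Lemma clique_inj : injective clique.
Proof.
move=> i j eq_ij; apply: val_inj; apply/eqP; rewrite eqn_leq.
have : i \in clique j by rewrite -eq_ij inE x_le leqnn.
have : j \in clique i by rewrite eq_ij inE x_le leqnn.
by rewrite !inE => /andP[_ ->] /andP[_ ->].
Qed.

Lemma peak_nesting_abscissa (v : 'I_m) :
  peak_nesting a v = #|[set j in peaks | x j <= v <= j]|.
Proof.
rewrite -(card_imset _ clique_inj); apply: eq_card => C.
rewrite !inE; apply/andP/imsetP.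
  case=> /imsetP[[i j]]; rewrite inE /= peak_edge_abscissa => /andP[/eqP ixj pj] ->.
  by rewrite ixj inE => v_in; exists j => //; rewrite !inE pj.
case=> j; rewrite !inE => /andP[pj v_in] ->; rewrite inE v_in; split=> //.
apply/imsetP; exists (Ordinal (leq_ltn_trans (x_le j) (ltn_ord j)), j) => //.
by rewrite inE /= peak_edge_abscissa eqxx.
Qed.

Variable k : nat.
Hypothesis k_bounds : 0 < k <= m.
(** The value at [m] is the abscissa of the N appended to L; it gives a meaning to [x j < x j.+1] at
    the last vertex. *)
Hypothesis x_last : x m = k.
Hypothesis x_eq0 : forall i : 'I_m, (x i == 0) = (i < k).

(** A vertex i with x_i = 0 sees the first vertex; any other has i >= k >= x_(m-1) and sees the last
    one. *)
Lemma abelian_abscissa : abelian a.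
Proof.
apply/forallP => i; apply/implyP => /andP[i_neq0 i_neqm].
have [xi0|] := eqVneq (x i) 0.
  apply/existsP; exists (Ordinal (leq_ltn_trans (leq0n i) (ltn_ord i))).
  by rewrite edge_abscissa /= xi0; lia.
rewrite x_eq0 => k_le.
have lt_m : m.-1 < m by lia.
apply/existsP; exists (Ordinal lt_m); rewrite edge_abscissa /=.
by have := @x_homo m.-1 m; have := ltn_ord i; lia.
Qed.

(* Every vertex v < k lies in no peak-clique whose left end is k, and every
   vertex v >= k misses the first peak-clique {0, ..., k - 1}.  Either way one
   peak is lost when the last peak has abscissa k; vertex k - 1 attains the
   bound. *)
Lemma pnest_abscissa : pnest a = #|[set j : 'I_m | x j < x j.+1]|.
Proof.
have lt_k1m : k.-1 < m by lia.
apply/eqP; rewrite eqn_leq; apply/andP; split.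
  apply/bigmax_leqP => v _; rewrite peak_nesting_abscissa.
  have [lt_vk|le_kv] := ltnP v k.
    apply: subset_leq_card; apply/subsetP => j; rewrite !inE.
    case/andP => /orP[//|/eqP jm] /andP[xjv vj]; rewrite jm x_last; lia.
  have lt_m : m.-1 < m by lia.
  have first_peak : Ordinal lt_k1m \in [set j : 'I_m | x j < x j.+1].
    rewrite inE /= prednK; last by lia.
    have := x_eq0 (Ordinal lt_k1m); have := x_eq0 (Ordinal (leq_ltn_trans le_kv (ltn_ord v))).
    by rewrite /=; lia.
  rewrite [leqRHS](cardsD1 (Ordinal lt_k1m)) first_peak.
  have sub : [set j in peaks | x j <= v <= j] \subset
     Ordinal lt_m |: ([set j : 'I_m | x j < x j.+1] :\ Ordinal lt_k1m).
    apply/subsetP => j; rewrite !inE => /andP[pj /andP[_ le_vj]].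
    rewrite -!val_eqE /=; lia.
  apply: leq_trans (subset_leq_card sub) _.
  by rewrite cardsU1 leq_add2r leq_b1.
apply: leq_trans (leq_bigmax (Ordinal lt_k1m)); rewrite peak_nesting_abscissa.
apply: subset_leq_card; apply/subsetP => j; rewrite !inE /= => lt_j.
rewrite lt_j /=; have := @x_homo j.+1 m (ltn_ord j).
have [le_k|lt_k] := leqP k j.+1; first by lia.
by have := x_eq0 (Ordinal (leq_trans lt_k (proj2 (andP k_bounds)))); rewrite /=; lia.
Qed.

End PeakNesting.

(** * Words in N and E *)

(* The number of factors EN in the word p W. *)
Definition turns (p : step) (W : seq step) : nat :=
  count id (pairmap (fun s s' => (s == E) && (s' == N)) p W).

Lemma turns_cons p s W : turns p (s :: W) = ((p == E) && (s == N)) + turns s W.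
Proof. by []. Qed.

Lemma N_abscissae_cat b u v :
  N_abscissae b (u ++ v) = N_abscissae b u ++ N_abscissae (b + count_mem E u) v.
Proof.
elim: u b => [|[] u IHu] b /=; rewrite ?addn0 ?IHu ?add0n //.
by rewrite addSnnS.
Qed.

Lemma N_abscissae_nseqN b k : N_abscissae b (nseq k N) = nseq k b.
Proof. by elim: k => //= k ->. Qed.

Lemma N_abscissae_nseqE b k : N_abscissae b (nseq k E) = [::].
Proof. by elim: k b => //= k IHk b. Qed.

Lemma size_N_abscissae b W : size (N_abscissae b W) = count_mem N W.
Proof. by elim: W b => [|[] W IHW] b //=; rewrite IHW. Qed.

Lemma size_steps W : size W = count_mem E W + count_mem N W.
Proof. by elim: W => [|[] W IHW] //=; rewrite IHW !add0n !add1n ?addnS. Qed.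

Lemma path_N_abscissae b c W : b <= c -> path leq b (N_abscissae c W).
Proof.
elim: W b c => [|[] W IHW] b c //= le_bc; first by rewrite le_bc IHW.
by rewrite IHW // ltnW.
Qed.

Lemma N_abscissae_gt0 L : ohead L = Some E -> all (leq 1) (N_abscissae 0 L).
Proof.
case: L => [|[] L] //= _; have := @path_N_abscissae 1 1 L isT.
by rewrite (path_sortedE leq_trans) => /andP[].
Qed.

Lemma N_abscissae_le b W : all (geq (b + count_mem E W)) (N_abscissae b W).
Proof.
elim: W b => [|[] W IHW] b //=; first by rewrite leq_addr add0n IHW.
by rewrite addnA addn1 IHW.
Qed.

(* Inverse of the map W |-> N_abscissae b W, on words W ending on the line
   x = k. *)
Fixpoint word_of_abscissae (b k : nat) (s : seq nat) : seq step :=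
  if s is c :: s' then nseq (c - b) E ++ N :: word_of_abscissae c k s'
  else nseq (k - b) E.

Lemma word_of_abscissaeK b k s : path leq b s -> all (geq k) s ->
  N_abscissae b (word_of_abscissae b k s) = s.
Proof.
elim: s b => [|c s IHs] b /=; first by rewrite N_abscissae_nseqE.
case/andP=> le_bc ps /andP[le_ck s_le]; rewrite N_abscissae_cat N_abscissae_nseqE /=.
by rewrite count_nseq /= mul1n subnKC // IHs.
Qed.

Lemma countE_word_of_abscissae b k s : path leq b s -> all (geq k) s -> b <= k ->
  count_mem E (word_of_abscissae b k s) = k - b.
Proof.
elim: s b => [|c s IHs] b /=; first by rewrite count_nseq /= mul1n.
case/andP=> le_bc ps /andP[le_ck s_le] _; rewrite count_cat count_nseq /=.
by rewrite IHs //; lia.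
Qed.

Lemma N_abscissaeK b W :
  word_of_abscissae b (b + count_mem E W) (N_abscissae b W) = W.
Proof.
elim: W b => [|[] W IHW] b; first by rewrite /= addn0 subnn.
  by rewrite /= subnn add0n IHW.
(* Starting at [b] instead of [b.+1] only puts one more E in front, because all later abscissae and
   the final one exceed [b]. *)
have := IHW b.+1; have := @path_N_abscissae b.+1 b.+1 W (leqnn _).
rewrite /= addnA addn1; have : b < b.+1 + count_mem E W by apply: leq_addr.
move: (b.+1 + _) => k lt_bk.
case: (N_abscissae b.+1 W) => [|c s] /=.
  have -> : k - b = (k - b.+1).+1 by lia.
  by move=> _ /= ->.
case/andP=> lt_bc _; have -> : c - b = (c - b.+1).+1 by lia.
by move=> /= ->.
Qed.

(** A factor EN ends at an N whose abscissa exceeds that of the preceding N. Here [b] is the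
    abscissa of the N before W, so the letter before W is E exactly when [b < c]; the default [k] is
    the abscissa of the appended N. *)
Lemma turns_N_abscissae b c W : b <= c ->
  let s := N_abscissae c W in let k := c + count_mem E W in
  \sum_(j < (size s).+1) (nth k (b :: s) j < nth k (b :: s) j.+1)
    = turns (if b < c then E else N) (rcons W N).
Proof.
elim: W b c => [|[] W IHW] b c le_bc.
- by rewrite /= big_ord_recl big_ord0 /turns /= !addn0; case: ifP.
- have /= := IHW c c (leqnn c); rewrite ltnn add0n => IH.
  rewrite /= big_ord_recl /= turns_cons -IH eqxx andbT; congr (_ + _).
  by case: ifP.
by have /= := IHW b c.+1 (leqW le_bc); rewrite ltnS le_bc addnA addn1 => ->;
   rewrite turns_cons andbF.
Qed.

(** * Abelian Dyck paths as words starting with E *)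

Definition abscissae_of_word (L : seq step) : seq nat :=
  nseq (count_mem E L) 0 ++ N_abscissae 0 L.

Definition path_of_word (L : seq step) : seq step :=
  nseq (count_mem E L) N ++ L ++ nseq (count_mem N L) E.

Lemma N_abscissae_path_of_word L :
  N_abscissae 0 (path_of_word L) = abscissae_of_word L.
Proof.
rewrite /path_of_word !N_abscissae_cat N_abscissae_nseqN N_abscissae_nseqE cats0.
by rewrite count_nseq.
Qed.

Lemma size_path_of_word L : size (path_of_word L) = 2 * size L.
Proof. by rewrite !size_cat !size_nseq [size L]size_steps; lia. Qed.

(** The initial N steps already match all the E steps of L, and the N steps of L match the final E
    steps. *)
Lemma dyck_path_of_word L : dyck_path (size L) (path_of_word L).
Proof.
have sL := size_steps L.
apply/and3P; split; try by rewrite !count_cat !count_nseq /= ?(mul0n, mul1n, add0n, addn0) sL.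
apply/forallP => -[p /= _]; rewrite /path_of_word !take_cat size_nseq.
case: ltnP => [lt_p|le_p]; first by rewrite take_nseq ?(ltnW lt_p) // !count_nseq.
rewrite !count_cat !count_nseq /= mul0n add0n mul1n.
case: ltnP => [_|le_p'].
  apply: leq_trans (leq_addr _ _).
  by rewrite -[X in _ <= count_mem E X](cat_take_drop (p - count_mem E L)) count_cat leq_addr.
rewrite !count_cat.
have [le|lt] := leqP (p - count_mem E L - size L) (count_mem N L).
  by rewrite take_nseq // !count_nseq /= mul1n mul0n addn0 leq_add2l.
by rewrite take_oversize ?size_nseq ?(ltnW lt) // !count_nseq /= mul1n mul0n addn0.
Qed.

Lemma size_abscissae_of_word L : size (abscissae_of_word L) = size L.
Proof. by rewrite size_cat size_nseq size_N_abscissae -size_steps. Qed.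

Section AreaOfWord.

Variables (m : nat) (L : seq step).
Hypotheses (size_L : size L = m) (head_L : ohead L = Some E).

Let k := count_mem E L.
Let x := nth k (abscissae_of_word L).

Lemma count_E_bounds : 0 < k <= m.
Proof.
by rewrite /k -size_L count_size andbT; case: L head_L => [|[]].
Qed.

Lemma abscissa_le i : x i <= k.
Proof.
have all_le : all (geq k) (abscissae_of_word L).
  by rewrite all_cat all_nseq orbT; have := N_abscissae_le 0 L; rewrite add0n.
rewrite /x; have [lt_i|le_i] := ltnP i (size (abscissae_of_word L)).
  by have /(all_nthP k) := all_le; apply.
by rewrite nth_default.
Qed.

Lemma abscissa_homo : {homo x : i j / i <= j}.
Proof.
have sorted_s : sorted leq (abscissae_of_word L).
  rewrite /abscissae_of_word; case: (count_mem E L) => [|l] /=.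
    by apply: (@path_sorted _ _ 0); apply: path_N_abscissae.
  by elim: l => [|l IHl] //=; apply: path_N_abscissae.
move=> i j le_ij; have [lt_j|le_j] := ltnP j (size (abscissae_of_word L)).
  by apply: (sorted_leq_nth leq_trans leqnn) => //; apply: leq_ltn_trans lt_j.
by rewrite {2}/x nth_default // abscissa_le.
Qed.

Lemma abscissa_eq0 i : i < m -> (x i == 0) = (i < k).
Proof.
move=> lt_im; rewrite /x nth_cat size_nseq -/k nth_nseq.
case: ltnP => [//|le_ki].
have /(all_nthP k)/(_ (i - k)) pos := N_abscissae_gt0 head_L.
apply/negbTE; rewrite -lt0n; apply: pos; rewrite size_N_abscissae.
by have := size_steps L; rewrite size_L -/k; lia.
Qed.

(** Below [k] the abscissa is 0; from [k] on it is at most [k]. *)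
Lemma abscissa_leq_id i : i < m -> x i <= i.
Proof.
by move=> lt_im; have := abscissa_eq0 lt_im; have := abscissa_le i; lia.
Qed.

Lemma abscissa_last : x m = k.
Proof. by rewrite /x nth_default // size_abscissae_of_word size_L. Qed.

Lemma area_of_wordE (i : 'I_m) : area_of_path m (path_of_word L) i = i - x i :> nat.
Proof.
rewrite ffunE /= N_abscissae_path_of_word; congr (_ - _).
by apply: set_nth_default; rewrite size_abscissae_of_word size_L.
Qed.

Lemma area_of_word_abelian :
  area_of_path m (path_of_word L) \in abelian_area_seqs m.
Proof.
have x_le_id (i : 'I_m) : x i <= i by apply: abscissa_leq_id.
have x_eq0 (i : 'I_m) : (x i == 0) = (i < k) by apply: abscissa_eq0.
rewrite inE (area_seq_abscissa area_of_wordE abscissa_homo) /=.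
exact: (abelian_abscissa area_of_wordE x_le_id abscissa_homo count_E_bounds
         abscissa_last x_eq0).
Qed.

Lemma pnest_area_of_word :
  pnest (area_of_path m (path_of_word L)) = turns N (rcons L N).
Proof.
have x_le_id (i : 'I_m) : x i <= i by apply: abscissa_leq_id.
have x_eq0 (i : 'I_m) : (x i == 0) = (i < k) by apply: abscissa_eq0.
rewrite (pnest_abscissa area_of_wordE x_le_id abscissa_homo count_E_bounds
         abscissa_last x_eq0).
have k_gt0 : 0 < k by case/andP: count_E_bounds.
(* Of the k initial N steps, the first is the leading entry 0 in [turns_N_abscissae]; the other k -
   1 create no factor EN. *)
have -> : turns N (rcons L N) = turns N (rcons (nseq k.-1 N ++ L) N).
  by elim: k.-1.
have xS j : x j.+1 = nth k (nseq k.-1 0 ++ N_abscissae 0 L) j.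
  by rewrite /x /abscissae_of_word -/k; case: (k) k_gt0.
have := @turns_N_abscissae 0 0 (nseq k.-1 N ++ L) (leqnn _).
rewrite ltnn /= => <-; rewrite N_abscissae_cat N_abscissae_nseqN !count_nseq.
rewrite count_cat count_nseq /= !mul0n !add0n -/k.
rewrite -[0 :: _]/(nseq k.-1.+1 0 ++ N_abscissae 0 L) prednK //.
have -> : (size (nseq k.-1 0 ++ N_abscissae 0 L)).+1 = m.
  by rewrite size_cat size_nseq -addSn prednK // size_N_abscissae -size_steps.
rewrite -sum1_card big_mkcond; apply: eq_bigr => j _; rewrite inE xS.
by rewrite -/(abscissae_of_word L) -/x; case: ifP.
Qed.

End AreaOfWord.

Lemma path_pair_of_word m (L : seq step) : size L = m -> ohead L = Some E ->
  path_pair m (count_mem E L) L (path_of_word L).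
Proof.
move=> size_L head_L; rewrite /path_pair (count_E_bounds size_L head_L) head_L.
have -> : m - count_mem E L = count_mem N L by rewrite -size_L size_steps addKn.
by rewrite /path_of_word !eqxx.
Qed.

Lemma path_pairE m k (L w : seq step) : path_pair m k L w ->
  w = path_of_word L /\ ohead L = Some E.
Proof.
case/and5P => _ /eqP cE /eqP cN /eqP -> /eqP ->.
by rewrite /path_of_word cE cN.
Qed.

(** As x_i <= i, no subtraction truncates and the area sequence gives back the abscissae. Their
    zeros number k, because L starts with E, and the remaining ones give back L. *)
Lemma area_of_word_inj m (L1 L2 : seq step) :
  size L1 = m -> size L2 = m -> ohead L1 = Some E -> ohead L2 = Some E ->
  area_of_path m (path_of_word L1) = area_of_path m (path_of_word L2) -> L1 = L2.
Proof.
move=> s1 s2 h1 h2 eq_a.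
have eq_x : abscissae_of_word L1 = abscissae_of_word L2.
  apply: (@eq_from_nth _ 0); first by rewrite !size_abscissae_of_word s1 s2.
  move=> i; rewrite size_abscissae_of_word s1 => lt_im.
  have := congr1 (fun a : {ffun 'I_m -> 'I_m} => nat_of_ord (a (Ordinal lt_im))) eq_a.
  rewrite /= !area_of_wordE //=.
  have := abscissa_leq_id s1 h1 lt_im; have := abscissa_leq_id s2 h2 lt_im.
  rewrite (set_nth_default 0) ?size_abscissae_of_word ?s2 //.
  rewrite (set_nth_default 0) ?size_abscissae_of_word ?s1 //.
  lia.
have zeros L : size L = m -> ohead L = Some E ->
    count_mem 0 (abscissae_of_word L) = count_mem E L.
  move=> sL hL; rewrite count_cat count_nseq mul1n.
  rewrite -[RHS]addn0; congr (_ + _); apply/count_memPn.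
  by apply/negP => /(allP (N_abscissae_gt0 hL)).
have eq_k : count_mem E L1 = count_mem E L2 by rewrite -!zeros ?eq_x.
have := congr1 (drop (count_mem E L1)) eq_x.
rewrite /abscissae_of_word {2}eq_k !drop_size_cat ?size_nseq // => eq_N.
by rewrite -(N_abscissaeK 0 L1) -(N_abscissaeK 0 L2) eq_k eq_N.
Qed.

(** The numbers i - a_i are nondecreasing. Their leading zeros give k, and L is the word whose
    abscissae are the positive ones. *)
Lemma area_of_word_surj m (a : {ffun 'I_m -> 'I_m}) : 0 < m ->
  a \in abelian_area_seqs m ->
  exists L : seq step, [/\ size L = m, ohead L = Some E &
                           a = area_of_path m (path_of_word L)].
Proof.
move=> m_gt0; rewrite inE => /andP[/andP[/forallP a_lt /forallP a_step] /forallP ab].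
pose s := [seq nat_of_ord i - a i | i <- enum 'I_m].
have size_s : size s = m by rewrite size_map size_enum_ord.
have sE (i : 'I_m) : nth 0 s i = i - a i.
  by rewrite (nth_map i) ?size_enum_ord ?ltn_ord // nth_ord_enum.
have sorted_s : sorted leq s.
  apply/(sortedP 0) => i; rewrite size_s => lt_i.
  have := sE (Ordinal lt_i); have := sE (Ordinal (ltnW lt_i)) => /= -> ->.
  by have /forallP/(_ (Ordinal (ltnW lt_i)))/implyP/= := a_step (Ordinal lt_i); lia.
have s_homo i j : i <= j < m -> nth 0 s i <= nth 0 s j.
  case/andP => le_ij lt_jm.
  by apply: (sorted_leq_nth leq_trans leqnn) => //; rewrite inE size_s //; lia.
pose k := find (ltn 0) s.
have le_km : k <= m by rewrite -size_s find_size.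
have zero_s i : i < k -> nth 0 s i = 0.
  by move/(before_find 0); rewrite /= lt0n => /negbFE/eqP.
have pos_s i : k <= i < m -> 0 < nth 0 s i.
  case/andP => le_ki lt_im; apply: leq_trans (s_homo k i _); last by rewrite le_ki.
  by apply: (@nth_find _ 0 (ltn 0)); rewrite has_find size_s -/k; lia.
have k_gt0 : 0 < k.
  rewrite lt0n; apply/negP => /eqP k0.
  by have := pos_s 0; rewrite k0 m_gt0 (sE (Ordinal m_gt0)) /=; lia.
(* Abelianness enters here: if k < m - 1, vertex k is not adjacent to the first vertex, hence it is
   adjacent to the last, which means s_(m-1) <= k. *)
have s_le i : i < m -> nth 0 s i <= k.
  move=> lt_im; have lt_m : m.-1 < m by lia.
  apply: leq_trans (s_homo i m.-1 _) _; first by lia.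
  have [lt_k|le_mk] := ltnP k m.-1; last first.
    by apply: leq_trans le_mk; rewrite (sE (Ordinal lt_m)) leq_subr.
  have lt_km : k < m by lia.
  have /implyP/(_ _)/existsP := ab (Ordinal lt_km).
  case=> [|/= l /andP[]]; first by rewrite /=; lia.
  have := pos_s k; rewrite leqnn lt_km (sE (Ordinal lt_km)) => /(_ isT) /= pos_k.
  rewrite (sE (Ordinal lt_m)) /edge /= => /orP[l0|lm]; first by lia.
  have -> : l = Ordinal lt_m by apply: val_inj; rewrite /=; lia.
  rewrite /=; lia.
pose s' := drop k s.
have s_cat : s = nseq k 0 ++ s'.
  rewrite -{1}(cat_take_drop k s); congr (_ ++ _).
  apply: (@eq_from_nth _ 0); first by rewrite size_takel ?size_nseq ?size_s.
  move=> i; rewrite size_takel ?size_s // => lt_ik.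
  by rewrite nth_take // nth_nseq lt_ik zero_s.
have s'_gt0 : all (leq 1) s'.
  apply/(all_nthP 0) => i; rewrite size_drop size_s => lt_i.
  by rewrite nth_drop pos_s; lia.
have s'_path : path leq 1 s'.
  by rewrite (path_sortedE leq_trans) s'_gt0 drop_sorted.
have s'_path0 : path leq 0 s'.
  by rewrite (path_sortedE leq_trans) drop_sorted // andbT; apply/allP.
have s'_le : all (geq k) s'.
  apply/(all_nthP 0) => i; rewrite size_drop size_s => lt_i.
  by rewrite nth_drop /= s_le; lia.
pose L := word_of_abscissae 0 k s'.
have cE : count_mem E L = k by rewrite countE_word_of_abscissae ?subn0.
have NL : N_abscissae 0 L = s' by rewrite word_of_abscissaeK.
exists L; split.
- by rewrite size_steps cE -(size_N_abscissae 0) NL size_drop size_s subnKC.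
- rewrite /L; case: (s') s'_path => [|c t] /=; rewrite subn0.
    by case: (k) k_gt0.
  by case: c.
apply/ffunP => i; apply: val_inj; rewrite ffunE /= N_abscissae_path_of_word.
rewrite /abscissae_of_word cE NL -s_cat sE subKn //.
by have := a_lt i; rewrite ltnS.
Qed.

(** * The gamma-polynomial *)

Local Open Scope ring_scope.

Lemma coef_1aXn (R : comNzRingType) (c : R) n j :
  ((1 + c *: 'X) ^+ n)`_j = c ^+ j *+ 'C(n, j).
Proof.
rewrite exprDn coef_sum.
under eq_bigr => i _ do rewrite expr1n mul1r exprZn coefMn coefZ coefXn.
have [lt_nj|le_jn] := ltnP n j.
  rewrite bin_small // mulr0n big1 // => i _.
  by rewrite (gtn_eqF (leq_trans (ltn_ord i) lt_nj)) mulr0 mul0rn.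
rewrite (bigD1 (Ordinal (le_jn : (j < n.+1)%N))) //= eqxx mulr1 big1 ?addr0 // => i.
by rewrite -val_eqE /= eq_sym => /negPf ->; rewrite mulr0 mul0rn.
Qed.

Lemma size_1aXn (R : comNzRingType) (c : R) n :
  (size ((1 + c *: 'X) ^+ n)%R <= n.+1)%N.
Proof.
by apply/leq_sizeP => j lt_nj; rewrite coef_1aXn bin_small // mulr0n.
Qed.

Lemma sum_odd_ord (V : nmodType) (F : nat -> V) s :
  \sum_(j < s.*2.+1 | odd j) F j = \sum_(i < s) F i.*2.+1.
Proof.
elim: s => [|s IHs]; first by rewrite big_mkcond !big_ord_recr !big_ord0 /= addr0.
rewrite [RHS]big_ord_recr -IHs doubleS big_mkcond 2!big_ord_recr -big_mkcond /=.
by rewrite odd_double /= addr0.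
Qed.

(** All exponents in X^j p(X^2) have the parity of j. *)
Lemma odd_polyXnM (R : comNzRingType) (p : {poly R}) j :
  odd_poly ('X^j * (p \Po 'X^2)) = if odd j then 'X^(j./2) * p else 0.
Proof.
apply/polyP => i; rewrite coef_odd_poly coefXnM coef_comp_poly_Xn //.
have [od_j|ev_j] := boolP (odd j).
  rewrite coefXnM; have -> : (i.*2.+1 < j)%N = (i < j./2)%N by lia.
  case: ltnP => // le_ji.
  have -> : (i.*2.+1 - j = (i - j./2) * 2)%N by lia.
  by rewrite dvdn_mull // mulnK.
rewrite coef0; case: ltnP => // le_ji; rewrite dvdn2.
by have -> : odd (i.*2.+1 - j) by lia.
Qed.

Definition gamma_poly n : {poly int} := odd_poly ((1 + 2 *: 'X) ^+ n).

Lemma gamma_polyE n : (1 <= n)%N ->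
  gamma_poly n = \sum_(i < ((n - 1)./2).+1)
                  (2 ^ (2 * i + 1) * 'C(n, 2 * i + 1))%:R *: 'X^i.
Proof.
move=> n_gt0; rewrite /gamma_poly (@odd_polyE _ ((n - 1)./2).+1) ?poly_def.
  apply: eq_bigr => i _; rewrite coef_1aXn addn1 mul2n.
  by rewrite natrM natrX mulr_natr.
by apply: leq_trans (size_1aXn _ _) _; lia.
Qed.

(** Writing p = e(X^2) + o(X^2) X, the terms e(s^2) cancel in p(s) - p(-s), leaving 2 s o(s^2). *)
Lemma horner_odd_poly (F : fieldType) (p : {poly F}) (s : F) :
  2 * s != 0 -> (odd_poly p).[s ^+ 2] = (p.[s] - p.[- s]) / (2 * s).
Proof.
move=> s_neq0; rewrite -{2 3}(poly_even_odd p) !hornerE !horner_comp !hornerE sqrrN.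
field; by move: s_neq0; rewrite mulf_eq0 negb_or andbC.
Qed.

Lemma horner_gamma_poly (F : fieldType) (t s : F) n :
  s ^+ 2 = t -> 2 * s != 0 ->
  (map_poly intr (gamma_poly n)).[t]
    = ((1 + 2 * s) ^+ n - (1 - 2 * s) ^+ n) / (2 * s).
Proof.
move=> <- s_neq0.
have -> : map_poly intr (gamma_poly n) = odd_poly ((1 + 2 *: 'X) ^+ n) :> {poly F}.
  apply/polyP => i; rewrite coef_map !coef_odd_poly !coef_1aXn.
  by rewrite raddfMn /= rmorphXn.
by rewrite horner_odd_poly // !hornerE mulrN.
Qed.

(** This is Pnest(t)/t for semilength 2n; inside [odd_poly], the variable stands for a square root
    of t. *)
Definition odd_binomial_poly n : {poly int} := odd_poly ((1 + 'X) ^+ (2 * n)).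

Lemma coef_odd_binomial_poly n i : (odd_binomial_poly n)`_i = 'C(2 * n, i.*2.+1)%:R.
Proof.
by rewrite coef_odd_poly -[X in 1 + X]scale1r coef_1aXn expr1n.
Qed.

Lemma size_odd_binomial_poly n : size (odd_binomial_poly n) = n.
Proof.
case: n => [|n]; first by rewrite /odd_binomial_poly expr0 -polyC1 odd_polyC size_poly0.
apply/eqP; rewrite eqn_leq; apply/andP; split.
  by apply/leq_sizeP => j le_j; rewrite coef_odd_binomial_poly bin_small //; lia.
rewrite ltnNge; apply/negP => /leq_sizeP/(_ n (leqnn n))/eqP.
rewrite coef_odd_binomial_poly pnatr_eq0 -leqn0 leqNgt bin_gt0; lia.
Qed.

Lemma degree_odd_binomial_poly n : degree (odd_binomial_poly n) = (n - 1)%N.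
Proof. by rewrite /degree size_odd_binomial_poly subn1. Qed.

Lemma symmetric_odd_binomial_poly n : (1 <= n)%N -> symmetric_poly (odd_binomial_poly n).
Proof.
move=> n_gt0; apply/polyP => i; rewrite coef_poly degree_odd_binomial_poly.
case: ltnP => [lt_i|le_i]; last first.
  by rewrite coef_odd_binomial_poly bin_small //; lia.
rewrite !coef_odd_binomial_poly -bin_sub; last by lia.
by congr ('C(_, _)%:R); lia.
Qed.

(** Expanding ((1 + X^2) + 2X)^n gives terms P_j X^j (1 + X^2)^(n-j). The odd part keeps j = 2i + 1
    and turns such a term into P_(2i+1) X^i (1 + X)^(n-1-2i). *)
Lemma gamma_expansion_odd_binomial_poly n : (1 <= n)%N ->
  odd_binomial_poly n = gamma_expansion (n - 1) (gamma_poly n).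
Proof.
move=> n_gt0; set P : {poly int} := (1 + 2 *: 'X) ^+ n.
have expand : (1 + 'X) ^+ (2 * n)
    = \sum_(j < n.+1) P`_j *: ('X^j * (((1 + 'X) ^+ (n - j)) \Po 'X^2)).
  rewrite exprM (_ : (1 + 'X) ^+ 2 = 1 + 'X ^+ 2 + 2 *: 'X); last first.
    by rewrite -mul_polyC; ring.
  rewrite exprDn; apply: eq_bigr => j _.
  rewrite /P coef_1aXn rmorphXn rmorphD rmorph1 /= comp_polyX.
  by rewrite exprZn -scalerAr -scalerMnl mulrC.
rewrite /odd_binomial_poly expand linear_sum /=.
under eq_bigr => j _ do rewrite linearZ /= odd_polyXnM.
pose s := ((n - 1)./2).+1.
pose F j := P`_j *: ('X^(j./2) * (1 + 'X) ^+ (n - j)) : {poly int}.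
transitivity (\sum_(j < n.+1 | odd j) F j).
  by rewrite [RHS]big_mkcond; apply: eq_bigr => j _; case: ifP; rewrite ?scaler0.
(* The new bound is n + 1 or n + 2 according to the parity of n; coefficients of [P] beyond n
   vanish. *)
transitivity (\sum_(j < s.*2.+1 | odd j) F j).
  rewrite (big_ord_widen_cond s.*2.+1 odd F); last by rewrite /s; lia.
  apply: esym; rewrite big_mkcond [RHS]big_mkcond; apply: eq_bigr => j _ /=.
  case: ltnP => [_|le_j]; rewrite ?andbT // andbF.
  by rewrite /F /P coef_1aXn bin_small ?mulr0n ?scale0r ?if_same.
rewrite sum_odd_ord; apply: eq_bigr => i _.
rewrite /F coef_odd_poly; congr (_ *: ('X^_ * _ ^+ _)); last by rewrite -subnDA mul2n.
by rewrite /= uphalf_double.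
Qed.

Lemma is_gamma_poly_odd_binomial_poly n : (1 <= n)%N ->
  is_gamma_poly (odd_binomial_poly n) (gamma_poly n).
Proof.
move=> n_gt0; rewrite /is_gamma_poly degree_odd_binomial_poly.
split; last exact: gamma_expansion_odd_binomial_poly.
apply: leq_trans (size_odd_poly _) _.
by rewrite -[leqRHS]/(n - 1).+2./2; apply: half_leq;
   apply: leq_trans (size_1aXn _ _) _; lia.
Qed.

(** * Counting words *)

Lemma sum_step (V : nmodType) (F : step -> V) : \sum_s F s = F N + F E.
Proof.
rewrite (bigD1 N) //= (bigD1 E) //= big1 ?addr0 // => s.
by case: s; rewrite ?eqxx.
Qed.

Lemma sum_tuple0 (V : nmodType) (T : finType) (F : seq T -> V) :
  \sum_(t : 0.-tuple T) F t = F [::].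
Proof.
by rewrite (big_pred1 [tuple]) // => t; apply/esym/eqP; exact: tuple0.
Qed.

Lemma sum_tupleS (V : nmodType) (T : finType) (l : nat) (F : seq T -> V) :
  \sum_(t : l.+1.-tuple T) F t = \sum_(s : T) \sum_(t : l.-tuple T) F (s :: t).
Proof.
rewrite pair_big /=.
rewrite (reindex (fun p : T * l.-tuple T => [tuple of p.1 :: p.2])) //=.
exists (fun t => (thead t, [tuple of behead t])) => [[s t] _|t _] /=.
  by congr pair; apply: val_inj.
by rewrite -tuple_eta.
Qed.

(* A word of length l + 2 that ends with N is determined by the set of the
   l + 1 places where the letter changes, which has even size if and only if the
   word starts with N. *)
Lemma sum_turns (l : nat) (p : step) :
  \sum_(t : l.-tuple step) 'X^(turns p (rcons t N)) =
    if p is N then even_poly ((1 + 'X) ^+ l.+1)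
    else odd_poly ((1 + 'X) ^+ l.+1) * 'X :> {poly int}.
Proof.
elim: l p => [|l IHl] p.
  rewrite (sum_tuple0 (fun t => 'X^(turns p (rcons t N)))) expr1.
  rewrite even_polyD odd_polyD -polyC1 even_polyC odd_polyC.
  rewrite -['X]mul1r even_polyMX odd_polyMX.
  rewrite -polyC1 even_polyC odd_polyC polyC1 mul0r addr0 add0r !mul1r.
  by case: p; rewrite /turns /= addn0 ?expr1.
rewrite (sum_tupleS _ (fun t => 'X^(turns p (rcons t N)))) sum_step.
under eq_bigr => t _ do rewrite rcons_cons turns_cons.
under [X in _ + X]eq_bigr => t _ do rewrite rcons_cons turns_cons andbF add0n.
under eq_bigr => t _ do rewrite exprD.
(* Prepending a letter corresponds to a factor 1 + X, whose term X swaps even and odd parts. *)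
rewrite -mulr_sumr !IHl [(1 + 'X) ^+ l.+2]exprSr mulrDr mulr1.
rewrite even_polyD odd_polyD even_polyMX odd_polyMX eqxx andbT.
by case: p; rewrite /= ?expr0 ?expr1; ring.
Qed.

(** * The peak-nesting polynomial as a sum over words *)

Lemma Pnest_words m : (0 < m)%N ->
  Pnest m = \sum_(L : m.-tuple step | ohead L == Some E) 'X^(turns N (rcons L N)).
Proof.
move=> m_gt0; pose f (L : m.-tuple step) := area_of_path m (path_of_word L).
have -> : Pnest m = \sum_(a in f @: [set L : m.-tuple step | ohead L == Some E]) 'X^(pnest a).
  apply: eq_bigl => a; apply/idP/imsetP => [/(area_of_word_surj m_gt0)|].
    case=> L [/eqP size_L head_L ->]; exists (Tuple size_L) => //.
    by rewrite inE head_L.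
  case=> L; rewrite inE => /eqP head_L ->.
  by apply: area_of_word_abelian; rewrite ?size_tuple.
rewrite big_imset => [|L1 L2].
  rewrite big_set; apply: eq_big => // L /eqP head_L.
  by rewrite (pnest_area_of_word (size_tuple L) head_L).
rewrite !inE => /eqP h1 /eqP h2 eq_f; apply: val_inj.
by apply: (area_of_word_inj (size_tuple L1) (size_tuple L2) h1 h2 eq_f).
Qed.

Lemma Pnest_odd_binomial_poly n : (0 < n)%N -> Pnest (2 * n) = odd_binomial_poly n * 'X.
Proof.
move=> n_gt0; rewrite Pnest_words ?muln_gt0 // big_mkcond /odd_binomial_poly.
have -> : (2 * n = (2 * n).-1.+1)%N by lia.
rewrite (sum_tupleS _ (fun L => if ohead L == Some E then 'X^(turns N (rcons L N)) else 0)).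
(* The first letter E becomes the preceding letter in [sum_turns], applied to the other 2n - 1
   letters. *)
by rewrite sum_step /= big1 // add0r -(sum_turns _ E).
Qed.

(** * Words without ENE and NEN at the prescribed places *)

Lemma no_ENE_NEN_cons n s s' (L : seq step) :
  no_ENE_NEN n.+1 (s :: s' :: L) =
  ~~ ((s != s') && (s' != head N L)) && no_ENE_NEN n L.
Proof.
(* The third letter of the first triple is the first letter of LN, hence the default N; a triple is
   forbidden when both of its adjacent pairs differ. *)
have first_triple : (take 3 (rcons (s :: s' :: L) N)
      \notin [:: [:: E; N; E]; [:: N; E; N]]) = ~~ ((s != s') && (s' != head N L)).
  by rewrite !inE; case: s; case: s'; case: L => [|[] L] /=; rewrite ?take0.
rewrite /no_ENE_NEN; apply/forallP/andP => [all_ok|[ok /forallP all_ok]].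
  split; first by rewrite -first_triple; exact: all_ok ord0.
  by apply/forallP => j; have := all_ok (lift ord0 j); rewrite lift0 mulnS.
move=> j; case: (unliftP ord0 j) => [i ->|->]; last by rewrite first_triple.
by rewrite lift0 mulnS; exact: all_ok.
Qed.

(* The letters of LN fall into n triples S_(2j-1) S_(2j) S_(2j+1), and each
   contributes at most one change of letter, in two possible places. *)
Lemma sum_turns_no_ENE_NEN n p :
  \sum_(L : n.*2.-tuple step | no_ENE_NEN n L && (head N L == p))
     'X^(turns N (rcons L N)) =
    if p is N then even_poly ((1 + 2 *: 'X) ^+ n)
    else odd_poly ((1 + 2 *: 'X) ^+ n) * 'X :> {poly int}.
Proof.
pose G n p (L : seq step) : {poly int} :=
  if no_ENE_NEN n L && (head N L == p) then 'X^(turns N (rcons L N)) else 0.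
transitivity (\sum_(L : n.*2.-tuple step) G n p L); first by rewrite big_mkcond.
elim: n p => [|n IHn] p.
  rewrite (sum_tuple0 (G 0 p)) expr0 -polyC1 even_polyC odd_polyC mul0r /G.
  have -> : no_ENE_NEN 0 [::] by apply/forallP; case.
  by case: p.
rewrite doubleS (sum_tupleS _ (G n.+1 p)).
under eq_bigr => s _ do rewrite (sum_tupleS _ (fun L => G n.+1 p (s :: L))).
have turnsE s (L : seq step) :
    turns s (rcons L N) = (((s == E) && (head N L == N)) + turns N (rcons L N))%N.
  by case: L => [|s' L]; rewrite //= !turns_cons.
(* The middle letter of the triple must agree with a neighbour, and the triple contains EN exactly
   when it starts with E and ends with N. *)
have G_cons s s' (L : seq step) : G n.+1 p (s :: s' :: L) =
    if s == p then
      match s, s' with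
      | N, N => G n N L + G n E L
      | N, E => G n E L
      | E, N => 'X * G n N L
      | E, E => 'X * G n N L + G n E L
      end
    else 0.
  rewrite /G no_ENE_NEN_cons !rcons_cons !turns_cons turnsE /=.
  by case: s; case: s'; case: (head N L); case: p;
     rewrite /= ?andbT ?andbF ?add0n ?addr0 ?add0r ?mulr0 //; case: ifP;
     rewrite ?exprS ?mulr0 ?addr0 ?add0r.
rewrite !sum_step.
under eq_bigr => L _ do rewrite G_cons.
under [X in _ + X + _]eq_bigr => L _ do rewrite G_cons.
under [X in _ + (X + _)]eq_bigr => L _ do rewrite G_cons.
under [X in _ + (_ + X)]eq_bigr => L _ do rewrite G_cons.
rewrite [(1 + 2 *: 'X) ^+ n.+1]exprSr mulrDr mulr1 -scalerAr.
rewrite even_polyD odd_polyD even_polyZ odd_polyZ even_polyMX odd_polyMX.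
case: p {G_cons} => /=; rewrite !sumr_const ?mul0rn ?big_split /= -?mulr_sumr !IHn.
  by rewrite -!mul_polyC; ring.
by rewrite -!mul_polyC; ring.
Qed.

(** A path determines its word L, and every word starting with E yields an Abelian Dyck path. *)
Lemma card_counted_paths n i : (0 < n)%N ->
  #|counted_paths n i| =
  #|[set L : (2 * n).-tuple step |
      [&& ohead L == Some E, no_ENE_NEN n L & turns N (rcons L N) == i.+1]]|.
Proof.
move=> n_gt0; set A := [set L : (2 * n).-tuple step | _].
have size_path (L : (2 * n).-tuple step) :
    size (path_of_word L) == (2 * (2 * n))%N.
  by rewrite size_path_of_word size_tuple.
pose f L := Tuple (size_path L).
rewrite -(card_in_imset (f := f) (D := A)); last first.
  move=> L1 L2; rewrite !inE => /and3P[/eqP h1 _ _] /and3P[/eqP h2 _ _] eq_f.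
  apply: val_inj; apply: (area_of_word_inj (size_tuple L1) (size_tuple L2) h1 h2).
  by rewrite -[path_of_word L1]/(val (f L1)) eq_f.
apply: eq_card => w; rewrite inE; apply/idP/imsetP => [/and4P[_ _ pn]|[L]].
  case/existsP => k /existsP[L /andP[/path_pairE[w_L head_L] ok]].
  exists L; last exact: val_inj.
  rewrite inE head_L ok eqxx /=.
  by rewrite -(pnest_area_of_word (size_tuple L) head_L) -w_L.
rewrite inE => /and3P[/eqP head_L ok tr] ->.
have := area_of_word_abelian (size_tuple L) head_L; rewrite inE => /andP[_ ab].
have := dyck_path_of_word L; rewrite size_tuple => dyck.
apply/and4P; split => //.
  by rewrite (pnest_area_of_word (size_tuple L) head_L).
have le_k : (count_mem E L < (2 * n).+1)%N.
  by rewrite ltnS -[leqRHS](size_tuple L) count_size.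
apply/existsP; exists (Ordinal le_k); apply/existsP; exists L.
by rewrite ok andbT; apply: path_pair_of_word; rewrite ?size_tuple.
Qed.

Lemma card_words_no_ENE_NEN n i :
  #|[set L : (2 * n).-tuple step |
      [&& ohead L == Some E, no_ENE_NEN n L & turns N (rcons L N) == i.+1]]|
  = (2 ^ (2 * i + 1) * 'C(n, 2 * i + 1))%N.
Proof.
apply/eqP; rewrite -(eqr_nat int) mul2n addn1 natrM natrX mulr_natr mul2n -coef_1aXn.
rewrite -coef_odd_poly -[X in X == _](_ : (odd_poly ((1 + 2 *: 'X) ^+ n) * 'X)`_i.+1 = _).
  by rewrite coefMX.
rewrite -(sum_turns_no_ENE_NEN n E) coef_sum -sum1_card natr_sum.
rewrite big_mkcond [RHS]big_mkcond; apply: eq_bigr => L _.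
rewrite inE coefXn [i.+1 == _]eq_sym.
(* With default N, the empty word fails both tests. *)
have -> : (ohead L == Some E) = (head N L == E) by case: (tval L) => [|[]].
by case: (no_ENE_NEN n L); case: (head N L == E) => //=; case: (turns _ _ == _).
Qed.

Theorem proposition4p7 (n : nat) (n_ge1 : (1 <= n)%N) :
  (exists q gamma : {poly int},
    [/\ Pnest (2 * n) = q * 'X,
        symmetric_poly q,
        is_gamma_poly q gamma,
        gamma = \sum_(i < ((n - 1)./2).+1)
                  (2 ^ (2 * i + 1) * 'C(n, 2 * i + 1))%:R *: 'X^i
      & forall (F : fieldType) (t sqrt_t : F),
          sqrt_t ^+ 2 = t -> 2 * sqrt_t != 0 ->
          (map_poly intr gamma).[t]
            = ((1 + 2 * sqrt_t) ^+ n - (1 - 2 * sqrt_t) ^+ n)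
              / (2 * sqrt_t)])
  /\ (forall i : nat, (i <= (n - 1)./2)%N ->
        (2 ^ (2 * i + 1) * 'C(n, 2 * i + 1))%N = #|counted_paths n i|).
Proof.
split; last by move=> i _; rewrite card_counted_paths // card_words_no_ENE_NEN.
exists (odd_binomial_poly n), (gamma_poly n); split.
- exact: Pnest_odd_binomial_poly.
- exact: symmetric_odd_binomial_poly.
- exact: is_gamma_poly_odd_binomial_poly.
- exact: gamma_polyE.
- by move=> F t s; apply: horner_gamma_poly.
Qed.
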